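(* Let $\mathcal{U},\mathcal{Y}$ be Hilbert spaces, $\mathcal{F}$ a closed subspace of $\mathcal{U}$, and $\omega=\begin{pmatrix}\omega_1\\ \omega_2\end{pmatrix}:\mathcal{F}\to\mathcal{Y}\oplus\mathcal{U}$ a contraction. Then there exists a unique solution to the $H^2$ interpolation problem defined by $\omega$ if and only if one of the following holds: (i) $\mathcal{F}=\mathcal{U}$; (ii) the operator $\omega_1(\Pi_{\mathcal{F}}\omega_2)^n:\mathcal{F}\to\mathcal{Y}$ is a co-isometry for every $n=0,1,2,\ldots$.
   Context: $\Pi_{\mathcal{F}}:\mathcal{U}\to\mathcal{F}$ is the orthogonal projection. $\mathfrak{H}^2(\mathcal{U},\mathcal{Y})$ denotes the set of functions $H$ on the open unit disc $\mathbb{D}$ with values bounded operators $\mathcal{U}\to\mathcal{Y}$ such that $(\Gamma_Hu)(\lambda)=H(\lambda)u$ defines a bounded operator $\Gamma_H:\mathcal{U}\to H^2(\mathcal{Y})$ (the $\mathcal{Y}$-valued Hardy space); it is normed by $\|H\|=\|\Gamma_H\|$, and $\mathfrak{H}^2_{\mathrm{ball}}(\mathcal{U},\mathcal{Y})$ is its closed unit ball. A solution to the $H^2$ interpolation problem defined by $\omega$ is a function $H\in\mathfrak{H}^2_{\mathrm{ball}}(\mathcal{U},\mathcal{Y})$ with $\omega_1+\lambda H(\lambda)\omega_2=H(\lambda)|_{\mathcal{F}}$ for all $\lambda\in\mathbb{D}$. *)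

(* Defs.v *)
From mathcomp Require Import all_boot all_algebra.
From mathcomp Require Import reals complex.
From Stdlib Require Import ClassicalEpsilon.
Import GRing.Theory Num.Theory.
Set Implicit Arguments. Unset Strict Implicit. Unset Printing Implicit Defensive.
Local Open Scope ring_scope.

Definition inner_product (R : realType) (V : lmodType R[i]) (ip : V -> V -> R[i]) : Prop :=
  [/\ (forall (a : R[i]) (x y z : V), ip (a *: x + y) z = a * ip x z + ip y z),
      (forall x y : V, ip x y = conjc (ip y x)),
      (forall x : V, 0 <= ip x x) &
      (forall x : V, ip x x = 0 -> x = 0)].

Definition hnorm (R : realType) (V : lmodType R[i]) (ip : V -> V -> R[i]) (x : V) : R :=
  Num.sqrt (complex.Re (ip x x)).

Definition seq_cvg (R : realType) (V : lmodType R[i]) (ip : V -> V -> R[i])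
  (s : nat -> V) (l : V) : Prop :=
  forall e : R, 0 < e -> exists N : nat, forall n, (N <= n)%N -> hnorm ip (s n - l) < e.

Definition cauchy_seq (R : realType) (V : lmodType R[i]) (ip : V -> V -> R[i])
  (s : nat -> V) : Prop :=
  forall e : R, 0 < e -> exists N : nat, forall m n, (N <= m)%N -> (N <= n)%N ->
    hnorm ip (s m - s n) < e.

Definition is_hilbert (R : realType) (V : lmodType R[i]) (ip : V -> V -> R[i]) : Prop :=
  inner_product ip /\
  (forall s : nat -> V, cauchy_seq ip s -> exists l, seq_cvg ip s l).

Definition closed_subspace (R : realType) (V : lmodType R[i]) (ip : V -> V -> R[i])
  (F : V -> Prop) : Prop :=
  [/\ F 0,
      (forall (a : R[i]) (x y : V), F x -> F y -> F (a *: x + y)) &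
      (forall (s : nat -> V) (l : V), (forall n, F (s n)) -> seq_cvg ip s l -> F l)].

Definition orth_proj (R : realType) (V : lmodType R[i]) (ip : V -> V -> R[i])
  (F : V -> Prop) (x : V) : V :=
  epsilon (inhabits (0 : V)) (fun p => F p /\ forall f, F f -> ip (x - p) f = 0).

Definition linear_on (R : realType) (U Y : lmodType R[i]) (F : U -> Prop) (f : U -> Y) : Prop :=
  forall (a : R[i]) (x y : U), F x -> F y -> f (a *: x + y) = a *: f x + f y.

Definition coisometry_on (R : realType) (U Y : lmodType R[i])
  (ipU : U -> U -> R[i]) (ipY : Y -> Y -> R[i]) (F : U -> Prop) (T : U -> Y) : Prop :=
  exists S : Y -> U,
    [/\ (forall y, F (S y)),
        (forall x y, F x -> ipY (T x) y = ipU x (S y)) &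
        (forall y, T (S y) = y)].

Definition taylor_coeffs (R : realType) (Y : lmodType R[i]) (ipY : Y -> Y -> R[i])
  (f : R[i] -> Y) (c : nat -> Y) : Prop :=
  forall l : R[i], `|l| < 1 ->
    seq_cvg ipY (fun N => \sum_(n < N) (l ^+ n *: c n)) (f l).

(* H in the closed unit ball of frak H^2(U,Y): each H(l) (|l|<1) is linear, and
   for every u the function l |-> H(l)u lies in H^2(Y) with
   ||Gamma_H u||^2 = sum_n ||c_n||^2 <= ||u||^2 *)
Definition H2_ball (R : realType) (U Y : lmodType R[i])
  (ipU : U -> U -> R[i]) (ipY : Y -> Y -> R[i]) (H : R[i] -> U -> Y) : Prop :=
  (forall l : R[i], `|l| < 1 -> linear_on (fun _ => True) (H l)) /\
  (forall u : U, exists c : nat -> Y,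
      taylor_coeffs ipY (fun l => H l u) c /\
      forall N : nat, \sum_(n < N) (hnorm ipY (c n)) ^+ 2 <= (hnorm ipU u) ^+ 2).

Definition H2_solution (R : realType) (U Y : lmodType R[i])
  (ipU : U -> U -> R[i]) (ipY : Y -> Y -> R[i]) (F : U -> Prop)
  (w1 : U -> Y) (w2 : U -> U) (H : R[i] -> U -> Y) : Prop :=
  H2_ball ipU ipY H /\
  (forall l : R[i], `|l| < 1 -> forall x, F x -> w1 x + l *: H l (w2 x) = H l x).

(* Main.v *)
(* On Taylor coefficients, a solution is a sequence of linear maps [K n : U -> Y] with
   [sum |K n u|^2 <= |u|^2], [K 0 = w1] and [K n.+1 = K n w2] on [F].  A contractive
   extension [Z] of [w] to [U] yields the solution [K n = Z1 Z2^n]; [Z = w P] yields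
   the central one [M n = w1 P (w2 P)^n].  If [T n = w1 (P w2)^n] is a co-isometry, a
   contraction equal to [T n] on [F] vanishes on the orthogonal complement of [F], so
   induction on [n] gives [K = M].  Conversely, if [e <> 0] is orthogonal to [F], perturb
   [w P] by a small multiple of [(1 - w w^* )(y, v) <., e>].  Uniqueness forces
   [w1 w1^* = 1], [w1 w2^* = 0] and [M n (1 - w2 w2^* ) = 0], whence [T n (T n)^* = 1]
   by induction. *)

Require Import Defs.
From mathcomp Require Import all_boot all_order all_algebra.
From mathcomp Require Import reals complex boolp classical_sets.
From mathcomp Require Import ring lra.
From Stdlib Require Import ClassicalEpsilon.
Import Order.TTheory GRing.Theory Num.Theory.
Local Open Scope ring_scope.
Local Open Scope complex_scope.
Local Notation Re := complex.Re.
Local Notation Im := complex.Im.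
Import ComplexField.Normc.

Set Implicit Arguments.
Unset Strict Implicit.
Unset Printing Implicit Defensive.

(** * Complex modulus and elementary real limits *)

Lemma normc_sqr (R : rcfType) (a : R[i]) : normc a ^+ 2 = Re a ^+ 2 + Im a ^+ 2.
Proof. by case: a => a b /=; rewrite sqr_sqrtr ?addr_ge0 ?sqr_ge0. Qed.

Lemma normc_ge0 (R : rcfType) (a : R[i]) : 0 <= normc a.
Proof. by case: a => a b; apply: sqrtr_ge0. Qed.

Lemma Re_le_normc (R : rcfType) (a : R[i]) : Re a <= normc a.
Proof.
have [a0|a0] := lerP (Re a) 0; first exact: le_trans a0 (normc_ge0 _).
rewrite -(@ler_pXn2r _ 2) ?nnegrE ?normc_ge0 ?(ltW a0) //.
by rewrite normc_sqr lerDl sqr_ge0.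
Qed.

Lemma normcX (R : rcfType) (a : R[i]) n : normc (a ^+ n) = normc a ^+ n.
Proof. by elim: n => [|n IH]; rewrite ?normc1 // !exprS normcM IH. Qed.

(** The norm [|l|] is itself an element of [R[i]]; this moves the disc condition to the real-valued
    [normc]. *)
Lemma norm_lt1 (R : rcfType) (l : R[i]) : (`|l| < 1) = (normc l < 1).
Proof. by rewrite normc_def -ltcR; case: l. Qed.

Lemma exists_invS_lt (R : realType) (e : R) : 0 < e ->
  exists N, forall n, (N <= n)%N -> n.+1%:R^-1 < e.
Proof.
move=> e0; have := archi_boundP (ltW (_ : 0 < e^-1)); rewrite invr_gt0 => /(_ e0) h.
exists (Num.bound e^-1) => n nN; rewrite -[e]invrK ltf_pV2 ?posrE ?invr_gt0 ?ltr0Sn //.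
by apply: lt_le_trans h _; rewrite ler_nat leqW.
Qed.

Lemma expr_vanish (R : realType) (r e : R) : 0 <= r -> r < 1 -> 0 < e ->
  exists N, forall n, (N <= n)%N -> r ^+ n < e.
Proof.
move=> r0 r1 e0.
(* A division-free Bernoulli inequality: it bounds [r ^+ n] by the inverse of [1 + n (1 - r)], so
   any [n] above [(e * (1 - r))^-1] works. *)
have bernoulli n : r ^+ n * (1 + n%:R * (1 - r)) <= 1.
  elim: n => [|n IH]; first by rewrite mul0r addr0 mulr1.
  apply: le_trans IH; rewrite exprSr -mulrA ler_wpM2l ?exprn_ge0 //.
  rewrite -natr1; have := ler0n R n; move: n%:R => k k0.
  rewrite -subr_ge0 (_ : _ - _ = (1 - r) ^+ 2 * (1 + k)); last by ring.
  by rewrite mulr_ge0 ?sqr_ge0 // addr_ge0.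
have h0 : 0 < (e * (1 - r))^-1 by rewrite invr_gt0 mulr_gt0 // subr_gt0.
have := archi_boundP (ltW h0); set N := Num.bound _ => hN.
exists N => n Nn; have s0 : 0 < 1 - r by rewrite subr_gt0.
have p0 : 0 < 1 + n%:R * (1 - r) by rewrite ltr_wpDr // mulr_ge0 // ltW.
rewrite -(ltr_pM2r p0); apply: le_lt_trans (bernoulli n) _.
have : (e * (1 - r))^-1 < n%:R by apply: lt_le_trans hN _; rewrite ler_nat.
rewrite -div1r ltr_pdivrMr ?mulr_gt0 //; move: n%:R => k; lra.
Qed.

(** * Maps linear on a subspace *)

Section LinearOn.
Context (R : realType) (V W : lmodType R[i]) (F : V -> Prop) (f : V -> W).
Hypotheses (F0 : F 0) (flin : linear_on F f).

Lemma linear_on0 : f 0 = 0.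
Proof.
by apply: (@addrI _ (f 0)); rewrite -{1}[f 0]scale1r -flin // scale1r !addr0.
Qed.

Lemma linear_onZ a x : F x -> f (a *: x) = a *: f x.
Proof. by move=> Fx; rewrite -[a *: x]addr0 flin // linear_on0 addr0. Qed.

Lemma linear_onD x y : F x -> F y -> f (x + y) = f x + f y.
Proof. by move=> Fx Fy; rewrite -{1}[x]scale1r flin // scale1r. Qed.

Lemma linear_onB x y : F x -> F y -> f (x - y) = f x - f y.
Proof. by move=> Fx Fy; rewrite addrC -scaleN1r flin // scaleN1r addrC. Qed.

End LinearOn.

(** * Inner product geometry and convergence in norm *)

Section InnerProduct.
Context (R : realType) (V : lmodType R[i]) (ip : V -> V -> R[i]).
Hypothesis ip_inner : inner_product ip.

(** Estimates are carried out on the squared norm, which expands polynomially into inner products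
    and avoids square roots. *)
Definition sqn (x : V) : R := Re (ip x x).

Lemma ipD_l x y z : ip (x + y) z = ip x z + ip y z.
Proof. by case: ip_inner => h _ _ _; rewrite -{1}[x]scale1r h mul1r. Qed.

Lemma ip0_l z : ip 0 z = 0.
Proof. by apply: (@addrI _ (ip 0 z)); rewrite -ipD_l !addr0. Qed.

Lemma ipZ_l a x z : ip (a *: x) z = a * ip x z.
Proof. by case: ip_inner => h _ _ _; rewrite -[a *: x]addr0 h ip0_l addr0. Qed.

Lemma ipN_l x z : ip (- x) z = - ip x z.
Proof. by rewrite -scaleN1r ipZ_l mulN1r. Qed.

Lemma ipB_l x y z : ip (x - y) z = ip x z - ip y z.
Proof. by rewrite ipD_l ipN_l. Qed.

Lemma ip_conj x y : ip x y = (ip y x)^*.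
Proof. by case: ip_inner. Qed.

Lemma ipD_r x y z : ip x (y + z) = ip x y + ip x z.
Proof. by rewrite ip_conj ipD_l rmorphD /= -!ip_conj. Qed.

Lemma ip0_r x : ip x 0 = 0.
Proof. by rewrite ip_conj ip0_l conjc0. Qed.

Lemma ipZ_r a x y : ip x (a *: y) = a^* * ip x y.
Proof. by rewrite ip_conj ipZ_l rmorphM /= -ip_conj. Qed.

Lemma ipN_r x y : ip x (- y) = - ip x y.
Proof. by rewrite ip_conj ipN_l rmorphN /= -ip_conj. Qed.

Lemma ipB_r x y z : ip x (y - z) = ip x y - ip x z.
Proof. by rewrite ipD_r ipN_r. Qed.

Lemma Re_ip_sym x y : Re (ip x y) = Re (ip y x).
Proof. by rewrite ip_conj; case: (ip y x). Qed.

(** In the order of [R[i]] a nonnegative element has zero imaginary part, so positivity already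
    makes [ip x x] real. *)
Lemma ip_self x : ip x x = (sqn x)%:C.
Proof.
case: ip_inner => _ _ /(_ x) h _.
by rewrite {1}[ip x x]complexE (ger0_Im h) mulr0 addr0.
Qed.

Lemma sqn_ge0 x : 0 <= sqn x.
Proof. by case: ip_inner => _ _ /(_ x) + _; rewrite ip_self lecR. Qed.

Lemma sqn_eq0 x : sqn x = 0 -> x = 0.
Proof. by case: ip_inner => _ _ _ h e; apply: h; rewrite ip_self e. Qed.

Lemma sqn0 : sqn 0 = 0.
Proof. by rewrite /sqn ip0_l. Qed.

Lemma sqnD x y : sqn (x + y) = sqn x + sqn y + 2 * Re (ip x y).
Proof.
rewrite /sqn ipD_l !ipD_r !raddfD /= [Re (ip y x)]Re_ip_sym; ring.
Qed.

Lemma sqnB x y : sqn (x - y) = sqn x + sqn y - 2 * Re (ip x y).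
Proof. by rewrite sqnD /sqn ipN_l !ipN_r opprK raddfN /= mulrN. Qed.

Lemma sqnZ a x : sqn (a *: x) = normc a ^+ 2 * sqn x.
Proof.
rewrite {1}/sqn ipZ_l ipZ_r ip_self; case: a => a b /=.
by rewrite sqr_sqrtr ?addr_ge0 ?sqr_ge0 //; ring.
Qed.

Lemma sqnZr (t : R) x : sqn (t%:C *: x) = t ^+ 2 * sqn x.
Proof. by rewrite sqnZ /= expr0n addr0 sqr_sqrtr ?sqr_ge0. Qed.

Lemma sqnN x : sqn (- x) = sqn x.
Proof. by rewrite /sqn ipN_l ipN_r opprK. Qed.

Lemma sqn_parallelogram x y : sqn (x + y) + sqn (x - y) = 2 * sqn x + 2 * sqn y.
Proof. rewrite sqnB sqnD; ring. Qed.

Lemma cauchy_schwarz x y : normc (ip x y) ^+ 2 <= sqn x * sqn y.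
Proof.
have [y0|y0] := eqVneq (sqn y) 0.
  by rewrite (sqn_eq0 y0) ip0_r normc0 expr0n sqn0 mulr0.
have := sqn_ge0 ((sqn y)%:C *: x - ip x y *: y).
rewrite sqnB sqnZr sqnZ ipZ_l ipZ_r.
have -> : Re ((sqn y)%:C * ((ip x y)^* * ip x y)) = sqn y * normc (ip x y) ^+ 2.
  rewrite normc_sqr; case: (ip x y) => a b /=; ring.
move=> h; have ypos : 0 < sqn y by rewrite lt_def y0 sqn_ge0.
rewrite -(ler_pM2l ypos) -subr_ge0; apply: le_trans h _.
by rewrite le_eqVlt; apply/orP; left; apply/eqP; ring.
Qed.

Lemma hnorm_sqr x : hnorm ip x ^+ 2 = sqn x.
Proof. exact: sqr_sqrtr (sqn_ge0 x). Qed.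

Lemma hnorm_ge0 x : 0 <= hnorm ip x.
Proof. exact: sqrtr_ge0. Qed.

Lemma hnorm_eq0 x : hnorm ip x = 0 -> x = 0.
Proof. by move=> h; apply: sqn_eq0; rewrite -hnorm_sqr h expr0n. Qed.

Lemma hnorm0 : hnorm ip 0 = 0.
Proof. by rewrite /hnorm ip0_l /= sqrtr0. Qed.

Lemma hnormZ a x : hnorm ip (a *: x) = normc a * hnorm ip x.
Proof.
apply/eqP; rewrite -(@eqrXn2 _ 2) ?hnorm_ge0 ?mulr_ge0 ?normc_ge0 ?hnorm_ge0 //.
by rewrite exprMn !hnorm_sqr sqnZ.
Qed.

Lemma hnormN x : hnorm ip (- x) = hnorm ip x.
Proof. by rewrite /hnorm -/(sqn _) sqnN. Qed.

Lemma hnorm_distC x y : hnorm ip (x - y) = hnorm ip (y - x).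
Proof. by rewrite -hnormN opprB. Qed.

Lemma Re_ip_le_hnorm x y : Re (ip x y) <= hnorm ip x * hnorm ip y.
Proof.
have h0 := hnorm_ge0; apply: le_trans (Re_le_normc _) _.
rewrite -(@ler_pXn2r _ 2) ?nnegrE ?mulr_ge0 ?normc_ge0 //.
by rewrite exprMn !hnorm_sqr cauchy_schwarz.
Qed.

Lemma hnorm_triangle x y : hnorm ip (x + y) <= hnorm ip x + hnorm ip y.
Proof.
have h0 := hnorm_ge0; rewrite -(@ler_pXn2r _ 2) ?nnegrE ?addr_ge0 //.
rewrite sqrrD !hnorm_sqr sqnD -mulr_natl; have := Re_ip_le_hnorm x y; lra.
Qed.

Lemma hnorm_lt_sqn x (e : R) : 0 < e -> (hnorm ip x < e) = (sqn x < e ^+ 2).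
Proof.
by move=> e0; rewrite -hnorm_sqr ltr_pXn2r // nnegrE ?hnorm_ge0 ?ltW.
Qed.

Lemma seq_cvgD s t l m :
  seq_cvg ip s l -> seq_cvg ip t m -> seq_cvg ip (fun n => s n + t n) (l + m).
Proof.
move=> hs ht e e0; have e2 : 0 < e / 2 by lra.
have [N hN] := hs _ e2; have [M hM] := ht _ e2.
exists (maxn N M) => n; rewrite geq_max => /andP[/hN a /hM b].
rewrite opprD addrACA; apply: le_lt_trans (hnorm_triangle _ _) _; lra.
Qed.

Lemma seq_cvgZ a s l :
  seq_cvg ip s l -> seq_cvg ip (fun n => a *: s n) (a *: l).
Proof.
move=> hs e e0; have a0 := normc_ge0 a.
have a1 : 0 < normc a + 1 by lra.
have [N hN] := hs (e / (normc a + 1)) (divr_gt0 e0 a1).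
exists N => n /hN; rewrite -scalerBr hnormZ ltr_pdivlMr // => h.
by apply: le_lt_trans h; rewrite mulrC ler_wpM2l ?hnorm_ge0 //; lra.
Qed.

Lemma seq_cvgB s t l m :
  seq_cvg ip s l -> seq_cvg ip t m -> seq_cvg ip (fun n => s n - t n) (l - m).
Proof.
move=> hs ht; have := seq_cvgD hs (seq_cvgZ (-1) ht).
by rewrite scaleN1r; under eq_fun do rewrite scaleN1r.
Qed.

Lemma seq_cvg_const l : seq_cvg ip (fun=> l) l.
Proof. by move=> e e0; exists 0%N => n _; rewrite subrr hnorm0. Qed.

Lemma seq_cvg_unique s l m : seq_cvg ip s l -> seq_cvg ip s m -> l = m.
Proof.
move=> hl hm; apply/eqP; rewrite -subr_eq0; apply/eqP/hnorm_eq0/eqP.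
rewrite eq_le hnorm_ge0 andbT leNgt; apply/negP => e0.
have [N hN] := seq_cvgB hm hl e0.
by have := hN N (leqnn _); rewrite subrr sub0r hnormN hnorm_distC ltxx.
Qed.

Lemma seq_cvg_shift s l : seq_cvg ip (fun n => s n.+1) l <-> seq_cvg ip s l.
Proof.
split=> h e e0; have [N hN] := h e e0.
  by exists N.+1 => -[//|n]; apply: hN.
by exists N => n nN; apply: hN; apply: leqW.
Qed.

End InnerProduct.

Lemma hnorm_le_sqn (R : realType) (V W : lmodType R[i]) (ipV : V -> V -> R[i])
  (ipW : W -> W -> R[i]) x y :
  sqn ipV x <= sqn ipW y -> hnorm ipV x <= hnorm ipW y.
Proof. exact: ler_wsqrtr. Qed.

(** * Riesz representation, orthogonal projection and adjoints *)

Section Riesz.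
Context (R : realType) (V : lmodType R[i]) (ip : V -> V -> R[i]) (F : V -> Prop).
Hypotheses (hilb : is_hilbert ip) (closedF : closed_subspace ip F).
Let Hip : inner_product ip := proj1 hilb.

Lemma closed_subspace0 : F 0.
Proof. by case: closedF. Qed.

Lemma closed_subspaceD x y : F x -> F y -> F (x + y).
Proof. by case: closedF => _ h _ fx fy; rewrite -[x]scale1r; apply: h. Qed.

Lemma closed_subspaceZ a x : F x -> F (a *: x).
Proof. by case: closedF => f0 h _ fx; rewrite -[_ *: _]addr0; apply: h. Qed.

Lemma closed_subspaceB x y : F x -> F y -> F (x - y).
Proof.
by move=> fx fy; rewrite -scaleN1r; apply/closed_subspaceD/closed_subspaceZ.
Qed.

(* The representing vector minimizes [sqn f - 2 Re (phi f)] over [F]; the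
   parallelogram law makes minimizing sequences Cauchy. *)
Lemma riesz (phi : V -> R[i]) (C : R) :
  (forall a x y, F x -> F y -> phi (a *: x + y) = a * phi x + phi y) ->
  (forall f, F f -> 2 * Re (phi f) <= sqn ip f + C) ->
  exists z, F z /\ forall f, F f -> phi f = ip f z.
Proof.
move=> philin phib; have F0 := closed_subspace0.
have phi0 : phi 0 = 0.
  by apply: (@addrI _ (phi 0)); rewrite -{1}[phi 0]mul1r -philin // scale1r !addr0.
have phiD x y : F x -> F y -> phi (x + y) = phi x + phi y.
  by move=> fx fy; rewrite -{1}[x]scale1r philin // mul1r.
have phiZ a x : F x -> phi (a *: x) = a * phi x.
  by move=> fx; rewrite -[a *: x]addr0 philin // phi0 addr0.
pose J f := sqn ip f - 2 * Re (phi f).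
pose E := [set r | exists2 f, F f & r = J f]%classic.
have lbE : has_lbound E by exists (- C) => _ [f Ff ->]; have := phib f Ff; rewrite /J; lra.
have infE : has_inf E by split => //; exists (J 0); exists 0.
have mJ f : F f -> inf E <= J f by move=> Ff; apply: ge_inf => //; exists f.
have [s hs] : exists s : nat -> V, forall n, F (s n) /\ J (s n) < inf E + n.+1%:R^-1.
  apply: (choice (fun n f => F f /\ J f < inf E + n.+1%:R^-1)) => n.
  have n0 : 0 < n.+1%:R^-1 :> R by rewrite invr_gt0 ltr0Sn.
  by have [_ [f Ff ->] h] := inf_adherent n0 infE; exists f.
have Fs n : F (s n) := (hs n).1.
have Js n : J (s n) < inf E + n.+1%:R^-1 := (hs n).2.
have dist n k : sqn ip (s n - s k) < 2 * n.+1%:R^-1 + 2 * k.+1%:R^-1.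
  (* At the midpoint [m] of [s n] and [s k], the parallelogram law gives [sqn (s n - s k) = 2 J (s
     n) + 2 J (s k) - 4 J m], and [J m] is at least [inf E]. *)
  have := mJ _ (closed_subspaceZ (2^-1)%:C (closed_subspaceD (Fs n) (Fs k))).
  rewrite /J phiZ; last exact: closed_subspaceD.
  rewrite phiD // sqnZr //.
  have -> a b : Re ((2^-1)%:C * (a + b)) = 2^-1 * (Re a + Re b) :> R.
    by case: a b => [a a'] [b b'] /=; ring.
  have := sqn_parallelogram Hip (s n) (s k); have := Js n; have := Js k.
  have -> : 2^-1 ^+ 2 = 4^-1 :> R by rewrite exprVn -natrX.
  rewrite /J; move: (n.+1%:R^-1) (k.+1%:R^-1) => a b; lra.
have cs : cauchy_seq ip s.
  move=> e e0; have e4 : 0 < e ^+ 2 / 4 by rewrite divr_gt0 ?exprn_gt0.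
  have [N hN] := exists_invS_lt e4.
  exists N => n k /hN h1 /hN h2; rewrite hnorm_lt_sqn //.
  apply: lt_trans (dist n k) _; move: h1 h2.
  move: (n.+1%:R^-1) (k.+1%:R^-1) (e ^+ 2) => a b c; lra.
have [l sl] := proj2 hilb s cs.
have Fl : F l by case: closedF => _ _; apply; first exact: Fs.
exists l; split => //.
(* First variation at the limit: if [D < 0], then moving from a late [s n] along [g] pushes [J]
   below its infimum. *)
have D0 g : F g -> Re (phi g) <= Re (ip l g).
  move=> Fg; rewrite leNgt -subr_lt0; apply/negP => D0.
  set D := Re (ip l g) - Re (phi g) in D0.
  have q0 := sqn_ge0 Hip g; set q := sqn ip g in q0.
  have q1 : 0 < q + 1 by lra.
  (* This [t] bounds the quadratic term [t ^+ 2 * q] by [- t D]. For late [n] the linear term is at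
     most [3 t D / 2], so [J] drops by at least [- t D / 2], more than the slack of [s n]. *)
  pose t := - D / (q + 1).
  have t0 : 0 < t by rewrite divr_gt0 //; lra.
  have tq : t * q <= - D.
    by rewrite /t mulrAC ler_pdivrMr //; nra.
  have e0 : 0 < - (t * D) / 2 by have : 0 < t * - D by [rewrite mulr_gt0 // oppr_gt0]; lra.
  have [N1 hN1] := exists_invS_lt e0.
  have d0 : 0 < - D / (4 * (hnorm ip g + 1)).
    by rewrite divr_gt0 ?oppr_gt0 // mulr_gt0 //; have := hnorm_ge0 ip g; lra.
  have [N2 hN2] := sl _ d0.
  pose n := maxn N1 N2.
  have h1 := hN1 n (leq_maxl _ _); have h2 := hN2 n (leq_maxr _ _).
  have dn : Re (ip (s n) g) - Re (ip l g) <= - D / 4.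
    have -> : Re (ip (s n) g) - Re (ip l g) = Re (ip (s n - l) g) by rewrite ipB_l // raddfB.
    apply: le_trans (Re_ip_le_hnorm Hip _ _) _.
    rewrite ltr_pdivlMr in h2; last by have := hnorm_ge0 ip g; lra.
    have := hnorm_ge0 ip (s n - l); lra.
  have := mJ _ (closed_subspaceD (Fs n) (closed_subspaceZ t%:C Fg)).
  rewrite /J phiD //; last exact: closed_subspaceZ.
  rewrite phiZ // sqnD // sqnZr // ipZ_r //.
  have -> : Re (t%:C^* * ip (s n) g) = t * Re (ip (s n) g).
    by case: (ip _ _) => a b /=; ring.
  have -> : Re (phi (s n) + t%:C * phi g) = Re (phi (s n)) + t * Re (phi g).
    by case: (phi g) (phi (s n)) => a b [c d] /=; ring.
  have := Js n; rewrite /J -/q => j1 j2.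
  have : t * (Re (ip (s n) g) - Re (phi g)) <= t * (3 / 4 * D).
    by rewrite ler_pM2l //; move: dn; rewrite /D; lra.
  have : t * (t * q) <= t * - D by rewrite ler_pM2l.
  move: h1 j1 j2; clearbody t D n; move: (n.+1%:R^-1) => a; lra.
have Req g : F g -> Re (phi g) = Re (ip g l).
  move=> Fg; rewrite (Re_ip_sym Hip); apply/eqP; rewrite eq_le D0 //=.
  (* Replacing [g] by [- g] reverses the inequality; below, replacing it by ['i *: g] recovers the
     imaginary parts. *)
  have := D0 _ (closed_subspaceZ (-1) Fg).
  by rewrite phiZ // mulN1r scaleN1r ipN_r // !raddfN /= lerN2.
move=> g Fg; apply/eqP; rewrite eq_complex Req // eqxx /=.
have := Req _ (closed_subspaceZ 'i Fg); rewrite phiZ // ipZ_l //.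
by case: (phi g) (ip g l) => a b [c d] /=; rewrite !mul0r !mul1r !sub0r => /oppr_inj ->.
Qed.

(** The [epsilon] in [orth_proj] is meaningful once a projection exists. It is the vector of [F]
    representing [f |-> ip f x], the bound required by [riesz] being [0 <= sqn (f - x)]. *)
Lemma orth_proj_spec x :
  F (orth_proj ip F x) /\ forall f, F f -> ip (x - orth_proj ip F x) f = 0.
Proof.
have ex : exists p, F p /\ forall f, F f -> ip (x - p) f = 0; last first.
  exact: (epsilon_spec (inhabits (0 : V)) _ ex).
have [||z [Fz hz]] := @riesz (ip^~ x) (sqn ip x).
- by move=> a y z _ _; rewrite ipD_l // ipZ_l.
- by move=> f _; have := sqn_ge0 Hip (f - x); rewrite sqnB //; lra.
exists z; split=> // f Ff.
by rewrite ip_conj // ipB_r // hz // subrr conjc0.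
Qed.

Lemma orth_proj_in x : F (orth_proj ip F x).
Proof. exact: (orth_proj_spec x).1. Qed.

Lemma orth_proj_orth x f : F f -> ip (x - orth_proj ip F x) f = 0.
Proof. exact: (orth_proj_spec x).2. Qed.

Lemma orth_proj_unique x p :
  F p -> (forall f, F f -> ip (x - p) f = 0) -> orth_proj ip F x = p.
Proof.
move=> Fp hp; apply/eqP; rewrite -subr_eq0; apply/eqP/(sqn_eq0 Hip).
rewrite /sqn; set d := _ - p.
have Fd : F d by apply: closed_subspaceB => //; apply: orth_proj_in.
have -> : ip d d = ip (x - p) d - ip (x - orth_proj ip F x) d.
  by rewrite -ipB_l // opprB addrC addrA subrK.
by rewrite hp // orth_proj_orth // subr0.
Qed.

Lemma orth_proj_id x : F x -> orth_proj ip F x = x.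
Proof. by move=> Fx; apply: orth_proj_unique => // f _; rewrite subrr ip0_l. Qed.

Lemma orth_proj_linear a x y :
  orth_proj ip F (a *: x + y) = a *: orth_proj ip F x + orth_proj ip F y.
Proof.
apply: orth_proj_unique.
  by apply: closed_subspaceD (orth_proj_in _); apply/closed_subspaceZ/orth_proj_in.
move=> f Ff; rewrite opprD addrACA -scalerBr ipD_l // ipZ_l //.
by rewrite !orth_proj_orth // mulr0 addr0.
Qed.

Lemma orth_proj_pythagoras x :
  sqn ip x = sqn ip (orth_proj ip F x) + sqn ip (x - orth_proj ip F x).
Proof.
rewrite -{1}[x](subrK (orth_proj ip F x)) (sqnD Hip (_ - _)).
by rewrite orth_proj_orth ?mulr0 ?addr0 1?addrC //; apply: orth_proj_in.
Qed.

(** Riesz representation of [x |-> ipW (T x) y] on [F]; the required bound follows from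
    [0 <= sqn (T f - y)] and contractivity. *)
Lemma adjoint_on (W : lmodType R[i]) (ipW : W -> W -> R[i]) (T : V -> W) :
  inner_product ipW -> linear_on F T ->
  (forall x, F x -> sqn ipW (T x) <= sqn ip x) ->
  exists S : W -> V, forall y, F (S y) /\ forall x, F x -> ipW (T x) y = ip x (S y).
Proof.
move=> HW Tlin Tb.
apply: (choice (fun y z => F z /\ forall x, F x -> ipW (T x) y = ip x z)) => y.
apply: (@riesz (fun x => ipW (T x) y) (sqn ipW y)).
  by move=> a x z Fx Fz; rewrite Tlin // ipD_l // ipZ_l.
move=> f /Tb h; have := sqn_ge0 HW (T f - y); rewrite sqnB //; lra.
Qed.

End Riesz.

(** * Vector-valued power series with bounded coefficients *)

Section PowerSeries.
Context (R : realType) (V : lmodType R[i]) (ip : V -> V -> R[i]).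
Hypothesis hilb : is_hilbert ip.
Let Hip : inner_product ip := proj1 hilb.

Definition power_sum (c : nat -> V) (l : R[i]) (N : nat) : V :=
  \sum_(n < N) (l ^+ n *: c n).

Lemma power_sumS c l N : power_sum c l N.+1 = power_sum c l N + l ^+ N *: c N.
Proof. exact: big_ord_recr. Qed.

Lemma power_sum_linear a c d l N :
  power_sum (fun n => a *: c n + d n) l N = a *: power_sum c l N + power_sum d l N.
Proof.
rewrite /power_sum scaler_sumr -big_split; apply: eq_bigr => n _ /=.
by rewrite scalerDr !scalerA mulrC.
Qed.

Lemma power_sum_recl c l N :
  power_sum c l N.+1 = c 0%N + l *: power_sum (fun n => c n.+1) l N.
Proof.
rewrite /power_sum big_ord_recl expr0 scale1r scaler_sumr; congr (_ + _).
by apply: eq_bigr => n _; rewrite scalerA -exprS.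
Qed.

(** The geometric tail estimate, multiplied by [1 - normc l] so that the right side telescopes and
    induction on [d] involves no quotient. *)
Lemma power_sum_dist c l (B : R) m d :
  (forall n, hnorm ip (c n) <= B) -> normc l < 1 ->
  hnorm ip (power_sum c l (m + d) - power_sum c l m) * (1 - normc l)
    <= B * (normc l ^+ m - normc l ^+ (m + d)).
Proof.
move=> cB l1; have s0 : 0 <= 1 - normc l by rewrite subr_ge0 ltW.
elim: d => [|d IH]; first by rewrite addn0 !subrr hnorm0 // mul0r mulr0.
rewrite addnS power_sumS addrAC.
apply: le_trans (ler_wpM2r s0 (hnorm_triangle Hip _ _)) _.
rewrite mulrDl hnormZ // normcX exprS.
have p0 : 0 <= normc l ^+ (m + d) * (1 - normc l).
  by rewrite mulr_ge0 ?exprn_ge0 ?normc_ge0.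
have := ler_wpM2l p0 (cB (m + d)%N); move: IH.
move: (normc l ^+ (m + d)) (normc l ^+ m) (hnorm _ _) (hnorm _ _) (normc l) => a b x y r.
lra.
Qed.

Lemma power_sum_tail c l (B : R) m n :
  (forall n, hnorm ip (c n) <= B) -> normc l < 1 -> (m <= n)%N ->
  hnorm ip (power_sum c l n - power_sum c l m) <= B / (1 - normc l) * normc l ^+ m.
Proof.
move=> cB l1 /subnKC <-; have h := power_sum_dist m (n - m) cB l1.
have B0 : 0 <= B := le_trans (hnorm_ge0 ip _) (cB 0%N).
rewrite mulrAC ler_pdivlMr ?subr_gt0 //; apply: le_trans h _.
by rewrite ler_wpM2l // gerBl exprn_ge0 // normc_ge0.
Qed.

Lemma power_sum_cvg c l (B : R) :
  (forall n, hnorm ip (c n) <= B) -> normc l < 1 ->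
  exists y, seq_cvg ip (power_sum c l) y.
Proof.
move=> cB l1; apply: (proj2 hilb) => e e0.
have B0 : 0 <= B := le_trans (hnorm_ge0 ip _) (cB 0%N).
have K0 : 0 <= B / (1 - normc l) by rewrite divr_ge0 // subr_ge0 ltW.
set K := B / _ in K0.
have K1 : 0 < K + 1 by lra.
have [N hN] := expr_vanish (normc_ge0 l) l1 (divr_gt0 e0 K1).
have main m n : (N <= m)%N -> (m <= n)%N -> hnorm ip (power_sum c l n - power_sum c l m) < e.
  move=> Nm mn; apply: le_lt_trans (power_sum_tail cB l1 mn) _.
  have := hN m Nm; rewrite ltr_pdivlMr // => h; apply: le_lt_trans h.
  by rewrite mulrC ler_wpM2l ?exprn_ge0 ?normc_ge0 // lerDl.
exists N => m n Nm Nn; have [mn|/ltnW nm] := leqP m n; last exact: main.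
by rewrite hnorm_distC //; apply: main.
Qed.

(** Strong induction: once the earlier coefficients vanish, the partial sums at a small real point
    are [r ^+ n *: c n] plus a tail of order [r ^+ n.+1]. *)
Lemma power_series_eq0 c (B : R) :
  (forall n, hnorm ip (c n) <= B) ->
  (forall l, normc l < 1 -> seq_cvg ip (power_sum c l) 0) ->
  forall n, c n = 0.
Proof.
move=> cB c0; apply: ltn_ind => n IH; apply: (hnorm_eq0 Hip); apply/eqP.
have B0 : 0 <= B := le_trans (hnorm_ge0 ip _) (cB 0%N).
rewrite eq_le hnorm_ge0 andbT leNgt; apply/negP => h0.
set h := hnorm ip (c n) in h0.
(* The first nonzero coefficient dominates the tail at [r = h / (2 B + 2 h)]. *)
have d0 : 0 < 2 * B + 2 * h by lra.
pose r := h / (2 * B + 2 * h); have r0 : 0 < r by rewrite divr_gt0.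
have r2 : r <= 2^-1 by rewrite ler_pdivrMr //; lra.
have nr : normc r%:C = r by rewrite /= expr0n addr0 sqrtr_sqr gtr0_norm.
have r1 : normc r%:C < 1 by rewrite nr; lra.
have psn : power_sum c r%:C n = 0.
  by rewrite /power_sum big1 // => i _; rewrite IH ?scaler0.
have rn0 : 0 < r ^+ n by rewrite exprn_gt0.
have e0 : 0 < r ^+ n * h / 4 by rewrite divr_gt0 ?mulr_gt0.
have [N hN] := c0 _ r1 _ e0.
(* The index [maxn N n.+1] makes the partial sum small and also ensures that it contains the term of
   degree [n]. *)
have h1 := hN (maxn N n.+1) (leq_maxl _ _).
have := power_sum_tail cB r1 (leq_maxr N n.+1).
rewrite subr0 in h1; move: h1; set S := power_sum _ _ (maxn _ _) => h1.
rewrite power_sumS psn add0r nr => h2.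
have h3 : r ^+ n * h <= hnorm ip S + hnorm ip (S - r%:C ^+ n *: c n).
  have -> : r ^+ n * h = hnorm ip (r%:C ^+ n *: c n) by rewrite hnormZ // normcX nr.
  rewrite -{1}[r%:C ^+ n *: c n](subKr S).
  by apply: le_trans (hnorm_triangle Hip _ _) _; rewrite hnormN.
have h4 : B / (1 - r) * r ^+ n.+1 <= r ^+ n * h / 2.
  have i0 : 0 <= r ^+ n by exact: ltW.
  have -> : B / (1 - r) * r ^+ n.+1 = r ^+ n * (B * r / (1 - r)) by rewrite exprSr; ring.
  have -> : r ^+ n * h / 2 = r ^+ n * (h / 2) by rewrite mulrA.
  rewrite ler_wpM2l // ler_pdivrMr; last lra.
  have : r * (2 * B + 2 * h) = h by rewrite /r divfK // gt_eqF.
  move: (r) r2 r0 => q *; nra.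
(* The estimates combine to [r ^+ n * h < (1/4 + 1/2) * (r ^+ n * h)]. *)
move: h1 h2 h3 h4 e0; rewrite -/h; lra.
Qed.

Lemma power_series_unique c d (B : R) f :
  (forall n, hnorm ip (c n) <= B) -> (forall n, hnorm ip (d n) <= B) ->
  taylor_coeffs ip f c -> taylor_coeffs ip f d -> forall n, c n = d n.
Proof.
move=> cB dB hc hd n; apply/eqP; rewrite -subr_eq0; apply/eqP.
apply: (@power_series_eq0 (fun n => c n - d n) (B + B)) => [k|l l1].
  by apply: le_trans (hnorm_triangle Hip _ _) _; rewrite hnormN // lerD.
rewrite -norm_lt1 in l1; rewrite -(subrr (f l)).
have := seq_cvgB Hip (hc l l1) (hd l l1).
congr (seq_cvg ip _ _); apply: funext => N.
by rewrite /power_sum -sumrB; apply: eq_bigr => k _; rewrite scalerBr.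
Qed.

End PowerSeries.

(** * Solutions and their Taylor coefficients *)

Section Interpolation.
Context (R : realType) (U Y : lmodType R[i]).
Context (ipU : U -> U -> R[i]) (ipY : Y -> Y -> R[i]).
Hypotheses (hU : is_hilbert ipU) (hY : is_hilbert ipY).
Context (F : U -> Prop).
Hypothesis hF : closed_subspace ipU F.
Context (w1 : U -> Y) (w2 : U -> U).
Hypotheses (hw1 : linear_on F w1) (hw2 : linear_on F w2).
Hypothesis contr : forall x, F x ->
  sqn ipY (w1 x) + sqn ipU (w2 x) <= sqn ipU x.
Let HU : inner_product ipU := proj1 hU.
Let HY : inner_product ipY := proj1 hY.
Let F0 : F 0 := closed_subspace0 hF.
Local Notation P := (orth_proj ipU F).
Let PF x : F (P x) := orth_proj_in hU hF x.

(** The last two clauses equate the coefficients of [l ^+ 0] and [l ^+ n.+1] in the interpolation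
    equation on [F]. *)
Definition coeff_solution (K : nat -> U -> Y) : Prop :=
  [/\ (forall n, linear_on (fun=> True) (K n)),
      (forall u N, \sum_(n < N) sqn ipY (K n u) <= sqn ipU u),
      (forall f, F f -> K 0%N f = w1 f) &
      (forall n f, F f -> K n.+1 f = K n (w2 f))].

Lemma sqn_le_of_sum (c : nat -> Y) (q : R) :
  (forall N, \sum_(n < N) sqn ipY (c n) <= q) -> forall n, sqn ipY (c n) <= q.
Proof.
move=> h n; apply: le_trans (h n.+1); rewrite big_ord_recr /= lerDr.
by apply: sumr_ge0 => i _; apply: sqn_ge0.
Qed.

Lemma coeff_contraction K n u : coeff_solution K -> sqn ipY (K n u) <= sqn ipU u.
Proof. by case=> _ h _ _; apply: (sqn_le_of_sum (c := K^~ u)). Qed.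

Lemma solution_of_coeffs K : coeff_solution K ->
  exists H, H2_solution ipU ipY F w1 w2 H /\
    forall u, taylor_coeffs ipY (fun l => H l u) (K^~ u).
Proof.
move=> Ksol; have [Klin Ksum K0 KS] := Ksol.
have Kb u n : hnorm ipY (K n u) <= hnorm ipU u.
  exact/hnorm_le_sqn/coeff_contraction.
have [H hH] : exists H : R[i] * U -> Y, forall p,
    normc p.1 < 1 -> seq_cvg ipY (power_sum (K^~ p.2) p.1) (H p).
  apply: (choice (fun p y =>
    normc p.1 < 1 -> seq_cvg ipY (power_sum (K^~ p.2) p.1) y)) => -[l u] /=.
  (* Values outside the disc are unconstrained; [0] is taken there. *)
  have [_|l1] := lerP 1 (normc l); first by exists 0.
  by have [y hy] := power_sum_cvg hY (Kb u) l1; exists y.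
have HH l u : `|l| < 1 -> seq_cvg ipY (power_sum (K^~ u) l) (H (l, u)).
  by rewrite norm_lt1 => l1; apply: (hH (l, u)).
exists (fun l u => H (l, u)); split; last by move=> u l; apply: HH.
split; first split.
- move=> l l1 a x y _ _; apply: (seq_cvg_unique HY (HH _ _ l1)).
  have := seq_cvgD HY (seq_cvgZ HY a (HH l x l1)) (HH l y l1).
  congr (seq_cvg ipY _ _); apply: funext => N; rewrite -power_sum_linear.
  by congr (power_sum _ l N); apply: funext => n; rewrite Klin.
- move=> u; exists (K^~ u); split; first by move=> l; apply: HH.
  by move=> N; rewrite hnorm_sqr //; under eq_bigr do rewrite hnorm_sqr //.
move=> l l1 x Fx.
(* The shift aligns the sum of [N.+1] terms at [x] with [w1 x] plus [l] times the sum of [N] terms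
   at [w2 x]. *)
apply: (seq_cvg_unique HY) (HH l x l1); apply/seq_cvg_shift.
have := seq_cvgD HY (seq_cvg_const HY (w1 x)) (seq_cvgZ HY l (HH l (w2 x) l1)).
congr (seq_cvg ipY _ _); apply: funext => N; rewrite power_sum_recl K0 //.
by congr (_ + _ *: power_sum _ _ _); apply: funext => n; rewrite KS.
Qed.

(** Coefficients are chosen separately for each [u]; uniqueness of power series then yields both
    their linearity in [u] and the recursion on [F]. *)
Lemma coeffs_of_solution H : H2_solution ipU ipY F w1 w2 H ->
  exists K, coeff_solution K /\ forall u, taylor_coeffs ipY (fun l => H l u) (K^~ u).
Proof.
move=> [[Hlin /choice [c hc]] Hint].
have cT u : taylor_coeffs ipY (fun l => H l u) (c u) by case: (hc u).
have cS u N : \sum_(n < N) sqn ipY (c u n) <= sqn ipU u.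
  case: (hc u) => _ /(_ N); rewrite hnorm_sqr //.
  by under eq_bigr do rewrite hnorm_sqr //.
have cB u n : hnorm ipY (c u n) <= hnorm ipU u.
  by apply/hnorm_le_sqn; apply: (sqn_le_of_sum (cS u)).
have cw f : F f -> forall n, c f n = if n is k.+1 then c (w2 f) k else w1 f.
  (* [B] need only dominate both coefficient sequences, so the separate bounds are added. *)
  move=> Ff; apply: (power_series_unique hY
    (B := hnorm ipU f + (hnorm ipU (w2 f) + hnorm ipY (w1 f)))) (cT f) _.
  - move=> n; apply: le_trans (cB f n) _.
    by rewrite lerDl addr_ge0 ?hnorm_ge0.
  - case=> [|n].
      by rewrite addrA lerDr addr_ge0 ?hnorm_ge0.
    apply: le_trans (cB _ n) _.
    by rewrite addrCA lerDl addr_ge0 ?hnorm_ge0.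
  move=> l l1; rewrite -Hint //; apply/seq_cvg_shift.
  have := seq_cvgD HY (seq_cvg_const HY (w1 f)) (seq_cvgZ HY l (cT (w2 f) l l1)).
  congr (seq_cvg ipY _ _); apply: funext => N.
  exact/esym/(power_sum_recl (fun n => if n is k.+1 then c (w2 f) k else w1 f)).
exists (fun n u => c u n); split; last exact: cT.
split=> [n a x y _ _|u N|f Ff|n f Ff]; last 2 first.
- by rewrite cw.
- by rewrite cw.
- apply: (power_series_unique hY (d := fun n => a *: c x n + c y n)
    (B := hnorm ipU (a *: x + y) + (normc a * hnorm ipU x + hnorm ipU y))) (cT _) _ n.
  + move=> k; apply: le_trans (cB _ k) _.
    by rewrite lerDl addr_ge0 ?mulr_ge0 ?normc_ge0 ?hnorm_ge0.
  + move=> k; apply: le_trans (hnorm_triangle HY _ _) _; rewrite hnormZ //.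
    apply: (@le_trans _ _ (normc a * hnorm ipU x + hnorm ipU y)).
      by rewrite lerD // ler_wpM2l ?normc_ge0.
    by rewrite lerDr hnorm_ge0.
  move=> l l1; rewrite Hlin //.
  have := seq_cvgD HY (seq_cvgZ HY a (cT x l l1)) (cT y l l1).
  congr (seq_cvg ipY _ _); apply: funext => N.
  exact/esym/power_sum_linear.
exact: cS.
Qed.

(** Both sequences sum to solutions, which coincide on the disc by hypothesis; uniqueness of
    expansions does the rest. *)
Lemma unique_solution_coeffs K L :
  (exists H, H2_solution ipU ipY F w1 w2 H /\
    forall H', H2_solution ipU ipY F w1 w2 H' ->
      forall l : R[i], `|l| < 1 -> forall u, H' l u = H l u) ->
  coeff_solution K -> coeff_solution L -> forall n u, K n u = L n u.
Proof.
move=> [H [_ Huniq]] hK hL n u.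
have [H1 [/Huniq e1 t1]] := solution_of_coeffs hK.
have [H2 [/Huniq e2 t2]] := solution_of_coeffs hL.
apply: (power_series_unique hY (c := K^~ u) (d := L^~ u) (f := fun l => H l u)
  (B := hnorm ipU u)) => [k|k|l l1|l l1].
- exact/hnorm_le_sqn/coeff_contraction.
- exact/hnorm_le_sqn/coeff_contraction.
- by rewrite -e1 //; apply: t1.
- by rewrite -e2 //; apply: t2.
Qed.

(* Any contractive extension [Z] of [w] to [U] gives the solution
   [H(l) = Z1 (1 - l Z2)^-1]. *)
Lemma extension_solution (Z1 : U -> Y) (Z2 : U -> U) :
  linear_on (fun=> True) Z1 -> linear_on (fun=> True) Z2 ->
  (forall u, sqn ipY (Z1 u) + sqn ipU (Z2 u) <= sqn ipU u) ->
  (forall f, F f -> Z1 f = w1 f) -> (forall f, F f -> Z2 f = w2 f) ->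
  coeff_solution (fun n u => Z1 (iter n Z2 u)).
Proof.
move=> l1 l2 zc z1 z2; split=> [n a x y _ _|u N|f Ff|n f Ff].
- rewrite -l1 //; congr Z1.
  by elim: n => //= n ->; rewrite l2.
(* Keeping the remainder [iter N Z2 u] closes the induction: contractivity splits it into the next
   term and the next remainder. *)
- have : \sum_(n < N) sqn ipY (Z1 (iter n Z2 u)) + sqn ipU (iter N Z2 u) <= sqn ipU u.
    elim: N => [|N IH]; first by rewrite big_ord0 add0r.
    by apply: le_trans IH; rewrite big_ord_recr /= -addrA lerD2l.
  by apply: le_trans; rewrite lerDl sqn_ge0.
- exact: z1.
- by rewrite iterSr z2.
Qed.

(** * The central solution and sufficiency of the two conditions *)

Definition central_coeff (n : nat) (u : U) : Y :=
  w1 (P (iter n (fun v => w2 (P v)) u)).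
Local Notation M := central_coeff.

Lemma central_coeffS n u : M n.+1 u = M n (w2 (P u)).
Proof. by rewrite /central_coeff iterSr. Qed.

(** Regrouping [P (w2 P)^n] as [(P w2)^n P] identifies the central coefficients on [F] with the
    operators of condition (ii). *)
Lemma central_coeffE n x :
  F x -> M n x = w1 (iter n (fun z => P (w2 z)) x).
Proof.
move=> Fx; rewrite /central_coeff; congr w1.
by elim: n => [|n IH] /=; rewrite ?IH // orth_proj_id.
Qed.

Lemma proj_linear : linear_on (fun=> True) P.
Proof. by move=> a x y _ _; apply: orth_proj_linear. Qed.

Lemma central_coeff_solution : coeff_solution M.
Proof.
apply: (extension_solution (Z1 := fun u => w1 (P u)) (Z2 := fun u => w2 (P u))).
- by move=> a x y _ _; rewrite proj_linear // hw1.
- by move=> a x y _ _; rewrite proj_linear // hw2.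
- move=> u; rewrite (orth_proj_pythagoras hU hF u).
  by apply: le_trans (contr (PF u)) _; rewrite lerDl sqn_ge0.
- by move=> f Ff; rewrite orth_proj_id.
- by move=> f Ff; rewrite orth_proj_id.
Qed.

(** The vector [f = S (L x)] of [F] satisfies [L f = L x] with [f] and [L x] of equal norm. As [x]
    is orthogonal to [f], contractivity at [t f + x] reads [(t + 1)^2 q <= t^2 q + sqn x], which
    fails for large [t] unless [q = 0]. *)
Lemma contraction_of_coisometry (T L : U -> Y) x :
  linear_on (fun=> True) L -> (forall u, sqn ipY (L u) <= sqn ipU u) ->
  (forall f, F f -> L f = T f) -> coisometry_on ipU ipY F T ->
  (forall f, F f -> ipU x f = 0) -> L x = 0.
Proof.
move=> Llin Lc LT [S [SF Sadj TS]] xF.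
pose f := S (L x); have Ff : F f := SF _.
have Lf : L f = L x by rewrite LT // TS.
have fq : sqn ipU f = sqn ipY (L x) by rewrite /sqn {2}/f -Sadj // TS.
apply: (sqn_eq0 HY); apply/eqP; rewrite eq_le sqn_ge0 // andbT leNgt.
apply/negP; set q := sqn ipY (L x) => q0.
(* With [t q = sqn x] the inequality reduces to [(t + 1) q <= 0]. *)
pose t := sqn ipU x / q.
have tq : t * q = sqn ipU x by rewrite divfK // gt_eqF.
have := Lc (t%:C *: f + x).
rewrite Llin // Lf -[X in _ + X](scale1r (L x)) -scalerDl.
rewrite -(rmorph1 (real_complex R)) -rmorphD sqnZr // sqnD // sqnZr // fq.
rewrite ipZ_l // (ip_conj HU f) xF // conjc0 mulr0 /= -/q.
have := sqn_ge0 HU x; move: (sqn ipU x) tq => s <- tq0.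
nra.
Qed.

Lemma coeffs_determined K :
  (forall u, F u) \/ (forall n, coisometry_on ipU ipY F
    (fun x => w1 (iter n (fun z => P (w2 z)) x))) ->
  coeff_solution K -> forall n u, K n u = M n u.
Proof.
move=> hyp Ksol; have [Klin _ K0 KS] := Ksol.
(* Agreement on [F] spreads to [U]: under (ii), [K n] kills [u - P u], while [M n] depends only on
   [P u]. *)
have KP n u : (forall f, F f -> K n f = M n f) -> K n u = M n u.
  case: hyp => [FU ->//|/(_ n) coiso KF].
  rewrite -{1}[u](subrK (P u)) (linear_onD (F := fun=> True)) //.
  have KT f : F f -> K n f = w1 (iter n (fun z => P (w2 z)) f).
    by move=> Ff; rewrite KF // central_coeffE.
  have -> : K n (u - P u) = 0.
    apply: (contraction_of_coisometry (Klin n) _ KT coiso) => [v|f Ff].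
      exact: coeff_contraction.
    exact: orth_proj_orth.
  rewrite add0r KF //; case: n {KF KT coiso} => [|n].
    by rewrite /central_coeff /= (orth_proj_id hU hF (PF u)).
  by rewrite !central_coeffS (orth_proj_id hU hF (PF u)).
elim=> [|n IH] u; apply: KP => f Ff.
  by rewrite K0 // /central_coeff /= orth_proj_id.
by rewrite KS // IH central_coeffS orth_proj_id.
Qed.

(* If [e] is orthogonal to [F] and [h = w^* (y, v)], then
   [w P + b (1 - w w^* ) (y, v) <., e>] is a contractive extension of [w] for small [b > 0];
   by uniqueness it induces the same coefficients as [w P]. *)
Lemma unique_defect (e : U) (y : Y) (v h : U) :
  (forall K L, coeff_solution K -> coeff_solution L -> forall n u, K n u = L n u) ->
  e <> 0 -> (forall f, F f -> ipU e f = 0) ->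
  F h -> (forall x, F x -> ipY (w1 x) y + ipU (w2 x) v = ipU x h) ->
  y = w1 h /\ forall n, M n v = M n (w2 h).
Proof.
move=> uniq e0 eF Fh hadj.
pose q := sqn ipU e * (sqn ipY y + sqn ipU v).
have q0 : 0 <= q by rewrite mulr_ge0 ?addr_ge0 ?sqn_ge0.
(* Scaling by [s] ensures [s ^+ 2 * q <= 1]; by Cauchy-Schwarz the perturbation [b u (y, v)] then
   has norm at most that of [u - P u]. *)
pose s := (1 + q)^-1; have s0 : 0 < s by rewrite invr_gt0; lra.
have sq : s ^+ 2 * q <= 1.
  have q1 : 0 < (1 + q) ^+ 2 by rewrite exprn_gt0 //; lra.
  by rewrite /s exprVn mulrC ler_pdivrMr // mul1r sqrrD; nra.
pose b u := s%:C * ipU u e.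
have blin a x z : b (a *: x + z) = a * b x + b z.
  by rewrite /b ipD_l // ipZ_l // mulrDr mulrCA.
have bF f : F f -> b f = 0.
  by move=> Ff; rewrite /b (ip_conj HU f) eF // conjc0 mulr0.
(* Absorbing [h] into the argument of [w] writes the perturbed extension as
   [w (g u) + b u (y, v)]. *)
pose g u := P u - b u *: h.
have gF u : F (g u).
  by apply: (closed_subspaceB hF); [exact: PF|exact: (closed_subspaceZ hF)].
have glin a x z : g (a *: x + z) = a *: g x + g z.
  rewrite /g blin proj_linear // scalerDl -scalerA opprD addrACA.
  by rewrite -scalerBr.
pose Z1 u := w1 (g u) + b u *: y.
pose Z2 u := w2 (g u) + b u *: v.
have sol : coeff_solution (fun n u => Z1 (iter n Z2 u)).
  apply: extension_solution.
  - move=> a x z _ _; rewrite /Z1 glin hw1 // blin scalerDl -scalerA addrACA.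
    by rewrite -scalerDr.
  - move=> a x z _ _; rewrite /Z2 glin hw2 // blin scalerDl -scalerA addrACA.
    by rewrite -scalerDr.
  - move=> u; rewrite /Z1 /Z2 !sqnD // !sqnZ // !ipZ_r //.
    have bn : normc (b u) ^+ 2 * (sqn ipY y + sqn ipU v) <= sqn ipU (u - P u).
      have -> : b u = s%:C * ipU (u - P u) e.
        by rewrite ipB_l // (ip_conj HU (P u)) eF // conjc0 subr0.
      rewrite normcM exprMn /= expr0n addr0 sqr_sqrtr ?sqr_ge0 //.
      have := cauchy_schwarz HU (u - P u) e.
      have d0 := sqn_ge0 HU (u - P u); have := ler_wpM2l d0 sq.
      have yv0 : 0 <= s ^+ 2 * (sqn ipY y + sqn ipU v).
        by rewrite mulr_ge0 ?sqr_ge0 ?addr_ge0 ?sqn_ge0.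
      move=> i1 /(ler_wpM2l yv0) i2; move: i1 i2; rewrite /q.
      by move: (s ^+ 2) => s2; lra.
    (* The cross terms match those of [P u = g u + b u *: h]. Contractivity at [g u] then leaves at
       most [sqn (P u) + sqn (u - P u) = sqn u]. *)
    have cross : Re ((b u)^* * ipY (w1 (g u)) y) + Re ((b u)^* * ipU (w2 (g u)) v)
        = Re (ipU (g u) (b u *: h)).
      by rewrite -raddfD -mulrDr hadj // ipZ_r.
    have := contr (gF u); have pyth := orth_proj_pythagoras hU hF u.
    have gPu : P u = g u + b u *: h by rewrite /g subrK.
    have := sqnD HU (g u) (b u *: h); rewrite -gPu.
    have := sqn_ge0 HU (b u *: h); lra.
  - by move=> f Ff; rewrite /Z1 /g bF // !scale0r subr0 addr0 orth_proj_id.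
  - by move=> f Ff; rewrite /Z2 /g bF // !scale0r subr0 addr0 orth_proj_id.
have ZM n u : Z1 (iter n Z2 u) = M n u := uniq _ _ sol central_coeff_solution n u.
have Pe : P e = 0 by apply: orth_proj_unique => // f Ff; rewrite subr0 eF.
have be : b e != 0.
  rewrite /b ip_self // -rmorphM -(rmorph0 (real_complex R)) (inj_eq (@complexI R)).
  rewrite mulf_neq0 ?gt_eqF //; rewrite lt_def sqn_ge0 // andbT.
  by apply/eqP => /(sqn_eq0 HU).
have w10 : w1 0 = 0 := linear_on0 F0 hw1.
have w20 : w2 0 = 0 := linear_on0 F0 hw2.
have ge : g e = (- b e) *: h by rewrite /g Pe sub0r scaleNr.
(* Both claims come from evaluation at [e], where every [M n] vanishes because [P e = 0], whereas
   [Z1 e = b e (y - w1 h)] and [Z2 e = b e (v - w2 h)] with [b e] nonzero. *)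
split.
  have := ZM 0%N e; rewrite /Z1 /central_coeff /= Pe w10 ge (linear_onZ F0 hw1) //.
  rewrite scaleNr addrC -scalerBr => /eqP; rewrite scaler_eq0 (negPf be) /= subr_eq0.
  by move/eqP.
move=> n; have Mlin : linear_on (fun=> True) (M n) by case: central_coeff_solution.
have := ZM n.+1 e; rewrite iterSr ZM central_coeffS Pe w20.
rewrite /Z2 ge (linear_onZ F0 hw2) // scaleNr addrC -scalerBr.
rewrite (linear_onZ _ Mlin) // (linear_onB Mlin) // (linear_on0 _ Mlin) //.
by move/eqP; rewrite scaler_eq0 (negPf be) /= subr_eq0 => /eqP.
Qed.

(** With [S1], [S2] the [F]-valued adjoints of [w1], [w2], the adjoint of [w1 (P w2)^n] is
    [S2^n S1]. The defect identities at [(y, 0)] and [(0, v)] give [w1 S1 = 1] and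
    [M k w2 S2 = M k], which cancel the factors one by one. *)
Lemma unique_coisometry (e : U) :
  (forall K L, coeff_solution K -> coeff_solution L -> forall n u, K n u = L n u) ->
  e <> 0 -> (forall f, F f -> ipU e f = 0) ->
  forall n, coisometry_on ipU ipY F (fun x => w1 (iter n (fun z => P (w2 z)) x)).
Proof.
move=> uniq e0 eF n.
have [|S1 hS1] := adjoint_on hU hF HY hw1.
  by move=> x /contr; apply: le_trans; rewrite lerDl sqn_ge0.
have [|S2 hS2] := adjoint_on hU hF HU hw2.
  by move=> x /contr; apply: le_trans; rewrite lerDr sqn_ge0.
have w1S1 y : w1 (S1 y) = y.
  have adj x : F x -> ipY (w1 x) y + ipU (w2 x) 0 = ipU x (S1 y).
    by move=> Fx; rewrite (hS1 y).2 // ip0_r // addr0.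
  by have [<- _] := unique_defect uniq e0 eF (hS1 y).1 adj.
have MS2 k v : M k (w2 (S2 v)) = M k v.
  have adj x : F x -> ipY (w1 x) 0 + ipU (w2 x) v = ipU x (S2 v).
    by move=> Fx; rewrite (hS2 v).2 // ip0_r // add0r.
  by have [_ ->] := unique_defect uniq e0 eF (hS2 v).1 adj.
pose A z := P (w2 z).
have SF k y : F (iter k S2 (S1 y)).
  by case: k => [|k] /=; [exact: (hS1 y).1|exact: (hS2 _).1].
exists (fun y => iter n S2 (S1 y)); split=> [y|x y Fx|y]; first exact: SF.
- have AF k : F (iter k A x) by case: k => [|k] //=; apply: PF.
  rewrite (hS1 y).2 //.
  (* The induction needs an arbitrary [z] of [F], since each step replaces [z] by [S2 z]. *)
  move: (S1 y) (hS1 y).1; elim: n => [//|n IH] z Fz.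
  rewrite [in RHS]iterSr -IH /=; last exact: (hS2 z).1.
  (* Since [z] lies in [F], applying [P] to the left argument leaves the inner product with [z]
     unchanged. *)
  rewrite -(hS2 z).2 // -/A; apply/eqP; rewrite eq_sym -subr_eq0 -ipB_l //.
  by rewrite orth_proj_orth.
rewrite -central_coeffE //.
elim: n => [|n IH]; first by rewrite /central_coeff /= orth_proj_id ?w1S1 //; case: (hS1 y).
by rewrite central_coeffS orth_proj_id ?MS2 //; apply: (hS2 _).1.
Qed.

End Interpolation.

Unset Implicit Arguments.
Local Close Scope complex_scope.

Theorem theorem0p2 (R : realType) (U Y : lmodType R[i])
  (ipU : U -> U -> R[i]) (ipY : Y -> Y -> R[i])
  (hU : is_hilbert ipU) (hY : is_hilbert ipY)
  (F : U -> Prop) (hF : closed_subspace ipU F)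
  (w1 : U -> Y) (w2 : U -> U)
  (hw1 : linear_on F w1) (hw2 : linear_on F w2)
  (hcontr : forall x, F x ->
     (hnorm ipY (w1 x)) ^+ 2 + (hnorm ipU (w2 x)) ^+ 2 <= (hnorm ipU x) ^+ 2) :
  (exists H : R[i] -> U -> Y,
     H2_solution ipU ipY F w1 w2 H /\
     forall H' : R[i] -> U -> Y, H2_solution ipU ipY F w1 w2 H' ->
       forall l : R[i], `|l| < 1 -> forall u, H' l u = H l u)
  <->
  ((forall u : U, F u) \/
   (forall n : nat,
      coisometry_on ipU ipY F
        (fun x => w1 (iter n (fun z => orth_proj ipU F (w2 z)) x)))).
Proof.
have [HU _] := hU; have [HY _] := hY.
have contr x : F x -> sqn ipY (w1 x) + sqn ipU (w2 x) <= sqn ipU x.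
  by move=> /hcontr; rewrite !hnorm_sqr.
split=> [uniq|hyp].
  have [FU|/existsNP[u uF]] := pselect (forall u, F u); [by left|right].
  (* A vector [u] outside [F] supplies the nonzero vector [u - P u] orthogonal to [F]. *)
  apply: (@unique_coisometry _ _ _ _ _ hU hY _ hF _ _ hw1 hw2 contr (u - orth_proj ipU F u)).
  - by move=> K L; apply: unique_solution_coeffs uniq.
  - by move/eqP; rewrite subr_eq0 => /eqP e; apply: uF; rewrite e; apply: orth_proj_in.
  - by move=> f; apply: orth_proj_orth.
have Msol := central_coeff_solution hU hF hw1 hw2 contr.
have [H [Hsol HT]] := solution_of_coeffs hU hY Msol.
exists H; split=> // H' /(coeffs_of_solution hU hY)[K [Ksol KT]] l l1 u.
(* Any other solution is the sum of the same power series as the central one. *)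
apply: (seq_cvg_unique HY) (KT u l l1) _.
have := HT u l l1; congr (seq_cvg ipY _ _); apply: funext => N.
apply: eq_bigr => n _; congr (_ *: _).
by rewrite (coeffs_determined hU hY hF hyp Ksol).
Qed.
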